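(* Let $(X,d)$ be a separable metric space and let $\Omega\subset X$ be non-empty, open and proper (i.e. $\Omega\neq X$). For any $p\ge 1$, the map $$\iota: Wb_p^1(\Omega)\to 2W_p(\Omega^* ),\qquad \iota(\mu)=\mu+(2-\mu(\Omega))[\![\partial]\!],$$ is an isometric embedding, i.e. $W_p(\iota(\mu),\iota(\nu))=Wb_p(\mu,\nu)$ for all $\mu,\nu\in Wb_p^1(\Omega)$.
   Context: Measures are non-negative Borel measures, $\mathcal M(Y)$ is the set of Borel measures on $Y$, and $[\![x]\!]$ is the Dirac mass at $x$. For a measure $\gamma$ on a product, $\pi_1\gamma$ and $\pi_2\gamma$ are its coordinate projections (push-forwards under $(x,y)\mapsto x$, $(x,y)\mapsto y$). Partial transport: for $\mu,\nu\in\mathcal M(\Omega)$ and $p\in[1,\infty)$, $$Wb_p(\mu,\nu)=\inf_\gamma\Big(\int_{X\times X}d(x,y)^p\,\mathrm d\gamma(x,y)\Big)^{1/p},$$ the infimum being over all $\gamma\in\mathcal M(X\times X)$ with $(\pi_1\gamma)|_\Omega=\mu$ and $(\pi_2\gamma)|_\Omega=\nu$. $Wb_p^1(\Omega)$ is the set of $\mu\in\mathcal M(\Omega)$ with $Wb_p(\mu,0)<\infty$ and $\mu(\Omega)\le 1$, equipped with $Wb_p$. Shortcut space: $\Omega^*=\Omega\cup\{\partial\}$, where $\partial$ is an additional point, with the metric $$\delta(x,y)=\min\{d(x,y),\ \operatorname{dist}(x,X\setminus\Omega)+\operatorname{dist}(y,X\setminus\Omega)\}\quad(x,y\in\Omega),\qquad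 \delta(x,\partial)=\operatorname{dist}(x,X\setminus\Omega).$$ Wasserstein distance: for measures $\alpha,\beta$ on $\Omega^*$, $W_p(\alpha,\beta)=\inf_\gamma(\int_{\Omega^*\times\Omega^*}\delta(x,y)^p\,\mathrm d\gamma(x,y))^{1/p}$, the infimum being over $\gamma\in\mathcal M(\Omega^*\times\Omega^* )$ with $\pi_1\gamma=\alpha$, $\pi_2\gamma=\beta$. $2W_p(\Omega^* )$ is the set of Borel measures $\alpha$ on $\Omega^*$ of total mass $2$ with $\int\delta(x,\partial)^p\,\mathrm d\alpha(x)<\infty$, equipped with $W_p$. *)

(* Defs.v *)
From HB Require Import structures.
From mathcomp Require Import all_boot all_order all_algebra.
From mathcomp Require Import all_classical all_reals all_analysis.
From mathcomp Require Import lra.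

Set Implicit Arguments.
Unset Strict Implicit.
Unset Printing Implicit Defensive.

Import Order.TTheory GRing.Theory Num.Theory.
Import numFieldNormedType.Exports.

Local Open Scope classical_set_scope.
Local Open Scope ring_scope.

Definition separable (T : topologicalType) :=
  exists2 S : set T, countable S & dense S.

(** In the library, a type carrying a sigma-algebra must be pointed. *)
Notation borel T := (@g_sigma_algebraType T open).

Record domain (R : realType) (X : metricType R) := Domain {
  domain_set :> set X ;
  domain_open : open domain_set ;
  domain_nonempty : domain_set !=set0 ;
  domain_proper : domain_set <> [set: X] }.

(** [ambient Omega] and [inner Omega] are the spaces X and Omega, with a base
    point obtained from the non-emptiness of Omega. *)
Definition ambient (R : realType) (X : metricType R) (Omega : domain X) : Type :=
  X.

Definition inner (R : realType) (X : metricType R) (Omega : domain X) : Type :=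
  set_type Omega.

Section pointed_spaces.
Context {R : realType} {X : metricType R} (Omega : domain X).

HB.instance Definition _ := Metric.copy (ambient Omega) X.
HB.instance Definition _ :=
  isPointed.Build (ambient Omega) (sval (cid (domain_nonempty Omega))).

HB.instance Definition _ :=
  Topological.copy (inner Omega) (set_type Omega).
HB.instance Definition _ := isPointed.Build (inner Omega)
  (SigSub (mem_set (svalP (cid (domain_nonempty Omega))))).

End pointed_spaces.

Definition inner_val (R : realType) (X : metricType R) (Omega : domain X)
  (x : inner Omega) : X := sval x.

(** dist(x, X \ Omega); the complement is non-empty, so [inf] is a true infimum. *)
Definition bdist (R : realType) (X : metricType R) (Omega : domain X)
  (x : X) : R := inf [set mdist x y | y in ~` Omega].

(** The point \partial is [None]. *)
Definition shortcut (R : realType) (X : metricType R) (Omega : domain X) : Type :=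
  option (inner Omega).

Definition bpoint (R : realType) (X : metricType R) (Omega : domain X) :
  shortcut Omega := None.

Definition incl (R : realType) (X : metricType R) (Omega : domain X)
  (x : inner Omega) : shortcut Omega := Some x.

Definition sdist (R : realType) (X : metricType R) (Omega : domain X)
    (x y : shortcut Omega) : R :=
  match x, y with
  | Some a, Some b =>
      Num.min (mdist (inner_val a) (inner_val b))
              (bdist Omega (inner_val a) + bdist Omega (inner_val b))
  | Some a, None => bdist Omega (inner_val a)
  | None, Some b => bdist Omega (inner_val b)
  | None, None => 0
  end.

Section shortcut_metric.
Context {R : realType} {X : metricType R} (Omega : domain X).
Implicit Types x y z : shortcut Omega.

Let domainC_nonempty : ~` (Omega : set X) !=set0.
Proof.
apply/set0P/eqP => O0; apply: (@domain_proper _ _ Omega).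
by rewrite -[LHS]setCK O0 setC0.
Qed.

Let bdist_has_inf (a : X) : has_inf [set mdist a y | y in ~` (Omega : set X)].
Proof.
split; first by have [b Ob] := domainC_nonempty; exists (mdist a b); exists b.
by exists 0 => _ [b _ <-]; exact: mdist_ge0.
Qed.

Lemma bdist_le (a b : X) : ~ (Omega : set X) b -> bdist Omega a <= mdist a b.
Proof. by move=> Ob; apply: (ge_inf (bdist_has_inf a).2); exists b. Qed.

Lemma bdist_ge0 (a : X) : 0 <= bdist Omega a.
Proof.
by apply: lb_le_inf; [exact: (bdist_has_inf a).1|
  move=> _ [b _ <-]; exact: mdist_ge0].
Qed.

Lemma bdist_lip (a b : X) : bdist Omega a <= mdist a b + bdist Omega b.
Proof.
rewrite -lerBlDl; apply: lb_le_inf; first exact: (bdist_has_inf b).1.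
move=> _ [c Oc <-]; rewrite lerBlDl.
exact: le_trans (bdist_le a Oc) (metric_triangle _ _ _).
Qed.

Lemma bdist_gt0 (a : X) : (Omega : set X) a -> 0 < bdist Omega a.
Proof.
move=> Oa; have := domain_open Omega; rewrite openE => /(_ _ Oa).
rewrite /interior => /nbhs_ballP[e /= e0 eO]; apply: (lt_le_trans e0).
apply: lb_le_inf; first exact: (bdist_has_inf a).1.
move=> _ [b Ob <-]; rewrite leNgt; apply/negP => abe; apply: Ob; apply: eO.
by rewrite ballEmdist.
Qed.

Let inner_gt0 (a : inner Omega) : 0 < bdist Omega (inner_val a).
Proof. by apply: bdist_gt0; exact: set_valP. Qed.

Let sdistxx x : sdist x x = 0.
Proof.
case: x => [a|//] /=; rewrite mdistxx; apply/min_idPl.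
by rewrite addr_ge0// bdist_ge0.
Qed.

Let sdist_positivity x y : sdist x y = 0 -> x = y.
Proof.
case: x y => [a|] [b|] //=; last 2 first.
- by move=> a0; have := inner_gt0 a; rewrite a0 ltxx.
- by move=> b0; have := inner_gt0 b; rewrite b0 ltxx.
have ha := inner_gt0 a; have hb := inner_gt0 b.
rewrite minEle; case: ifPn => _ ab0; last by exfalso; lra.
by congr Some; apply: val_inj; exact: mdist_positivity ab0.
Qed.

Let sdist_sym x y : sdist x y = sdist y x.
Proof. by case: x y => [a|] [b|] //=; rewrite metric_sym addrC. Qed.

Let sdist_triangle y x z : sdist x z <= sdist x y + sdist y z.
Proof.
case: x y z => [a|] [b|] [c|] //=; rewrite ?addr0 ?add0r//.
- rewrite ge_min !minEle.
  have abc := metric_triangle (inner_val a) (inner_val b) (inner_val c).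
  have := bdist_lip (inner_val a) (inner_val b).
  have := bdist_lip (inner_val c) (inner_val b).
  rewrite [mdist (inner_val c) _]metric_sym.
  have := bdist_ge0 (inner_val b).
  case: ifPn => _; case: ifPn => _ h1 h2 h3; apply/orP; [left|right..]; lra.
- rewrite minEle; have := bdist_lip (inner_val a) (inner_val b).
  by have := bdist_ge0 (inner_val b); case: ifPn => _; lra.
- by rewrite ge_min lexx orbT.
- rewrite minEle; have := bdist_lip (inner_val c) (inner_val b).
  rewrite [mdist (inner_val c) _]metric_sym.
  by have := bdist_ge0 (inner_val b); case: ifPn => _; lra.
- by rewrite addr_ge0// bdist_ge0.
Qed.

HB.instance Definition _ := Choice.on (shortcut Omega).
HB.instance Definition _ := isMetric.Build R (shortcut Omega)
  sdistxx sdist_positivity sdist_sym sdist_triangle.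
HB.instance Definition _ := isPointed.Build (shortcut Omega) (bpoint Omega).

Lemma incl_continuous : continuous (@incl _ _ Omega).
Proof.
move=> x U /nbhs_ballP[e /= e0 eU].
have xe : nbhs (inner_val x) (ball (inner_val x) e) by exact: nbhsx_ballx.
have xV : nbhs x (@inner_val _ _ Omega @^-1` ball (inner_val x) e).
  exact: (@initial_continuous _ X (@set_val X Omega) x _ xe).
apply: filterS xV => y; rewrite /preimage /= ballEmdist /= => xye; apply: eU.
by rewrite ballEmdist /= gt_min xye.
Qed.

Lemma measurable_incl : measurable_fun [set: borel (inner Omega)]
  (@incl _ _ Omega : borel (inner Omega) -> borel (shortcut Omega)).
Proof.
apply: (@measurability _ _ (borel (inner Omega)) (borel (shortcut Omega)) _ _
  (@open (shortcut Omega))); first by [].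
move=> _ [B oB <-]; rewrite setTI; apply: sub_sigma_algebra.
by move/continuousP : incl_continuous; exact.
Qed.

End shortcut_metric.

Section marginals.
Context {R : realType} {T : ptopologicalType}.
Variable gamma : {measure set (borel (T * T)%type) -> \bar R}.

Definition marginal1 : set (borel T) -> \bar R :=
  pushforward gamma (fst : borel (T * T)%type -> borel T).

Definition marginal2 : set (borel T) -> \bar R :=
  pushforward gamma (snd : borel (T * T)%type -> borel T).

End marginals.

Section transport.
Local Open Scope ereal_scope.
Context {R : realType} {X : metricType R} (Omega : domain X).
Implicit Types (p : R) (mu nu : {measure set (borel (inner Omega)) -> \bar R}).
Implicit Types alpha beta : {measure set (borel (shortcut Omega)) -> \bar R}.

(** The restriction of a Borel measure on X to a Borel measure on the subspace
    Omega; the image of a Borel set of Omega is Borel in X as Omega is open. *)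
Definition restr (m : set X -> \bar R) (A : set (inner Omega)) : \bar R :=
  m (@inner_val _ _ Omega @` A).

(** Only the restrictions of the marginals to Omega are prescribed; [gamma] is
    arbitrary, possibly infinite, outside. *)
Definition partial_coupling mu nu
    (gamma : {measure set (borel (ambient Omega * ambient Omega)%type) -> \bar R}) :=
  forall A : set (borel (inner Omega)), measurable A ->
    restr (marginal1 gamma) A = mu A /\ restr (marginal2 gamma) A = nu A.

Definition Wb p mu nu : \bar R :=
  ereal_inf [set (\int[gamma]_z ((mdist z.1 z.2 `^ p)%:E)) `^ p^-1
            | gamma in partial_coupling mu nu].

Record Wb1 p := mkWb1 {
  Wb1_measure :> {measure set (borel (inner Omega)) -> \bar R} ;
  Wb1_finite : Wb p Wb1_measure mzero < +oo ;
  Wb1_mass : Wb1_measure setT <= 1 }.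

Definition coupling alpha beta
    (gamma : {measure set (borel (shortcut Omega * shortcut Omega)%type) -> \bar R}) :=
  forall A : set (borel (shortcut Omega)), measurable A ->
    marginal1 gamma A = alpha A /\ marginal2 gamma A = beta A.

Definition W p alpha beta : \bar R :=
  ereal_inf [set (\int[gamma]_z ((mdist z.1 z.2 `^ p)%:E)) `^ p^-1
            | gamma in coupling alpha beta].

Definition twoW p alpha :=
  alpha setT = 2%:E /\ \int[alpha]_x ((mdist x (bpoint Omega) `^ p)%:E) < +oo.

Definition incl_pushforward mu : set (borel (shortcut Omega)) -> \bar R :=
  pushforward mu (@incl _ _ Omega : _ -> borel (shortcut Omega)).

Section incl_pushforward_measure.
Variable mu : {measure set (borel (inner Omega)) -> \bar R}.

Let m : {measure set (borel (shortcut Omega)) -> \bar R} :=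
  measure_function_pushforward__canonical__measure_function_Measure mu
    (@measurable_incl _ _ Omega).

HB.instance Definition _ := isMeasure.Build _ _ _ (incl_pushforward mu)
  (@measure0 _ _ _ m) (@measure_ge0 _ _ _ m)
  (@measure_semi_sigma_additive _ _ _ m).

End incl_pushforward_measure.

Section embedding.
Variables (p : R) (mu : Wb1 p).

Lemma remaining_mass_ge0 : (0 <= 2 - fine (mu setT))%R.
Proof.
have := Wb1_mass mu; have := measure_ge0 mu setT.
by case: (mu setT) => [r| |] //=; rewrite ?lee_fin => _; lra.
Qed.

Definition embed : {measure set (borel (shortcut Omega)) -> \bar R} :=
  measure_add (incl_pushforward mu)
    (mscale (NngNum remaining_mass_ge0)
      (dirac (bpoint Omega : borel (shortcut Omega)))).

Lemma embedE (A : set (borel (shortcut Omega))) :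
  embed A = mu (@incl _ _ Omega @^-1` A) +
            (2 - fine (mu setT))%:E * \d_(bpoint Omega : borel (shortcut Omega)) A.
Proof. exact: measure_addE. Qed.

End embedding.
End transport.

(* Main.v *)
(** A partial coupling of [mu] and [nu] is pushed to Omega^* x Omega^* by
    collapsing X \ Omega to the point \partial, which does not increase
    distances; only the part touching Omega is kept, and an atom at
    (\partial, \partial), which costs nothing, brings the total mass to 2.
    Conversely, given a coupling on Omega^* x Omega^*, a pair (x, y) with
    delta(x, y) < delta(x, \partial) + delta(y, \partial) is transported directly,
    at the same cost. In all other cases x is sent to a point b(x) outside Omega,
    and y is reached from b(y), where d(x, b(x)) <= c dist(x, X \ Omega) for a
    fixed c > 1; since s^p + t^p <= (s + t)^p this multiplies the cost by at most
    c^p, and c tends to 1. Separability provides a measurable b, and makes the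
    Borel sigma-algebra of X x X the product one. *)

Require Import Defs.
From HB Require Import structures.
From mathcomp Require Import all_boot all_order all_algebra.
From mathcomp Require Import all_classical all_reals all_analysis.
From mathcomp Require Import measurable_realfun lra.

Import Order.TTheory GRing.Theory Num.Theory.
Import numFieldNormedType.Exports.

Local Open Scope classical_set_scope.
Local Open Scope ring_scope.

(** The library provides pointed and topological products, but not their join. *)
HB.instance Definition _ (S T : ptopologicalType) := Pointed.on (S * T)%type.

(** * Continuity of the metric and countability properties *)

Lemma mdist_continuous (R : realType) (T : metricType R) :
  continuous (fun z : T * T => mdist z.1 z.2 : R^o).
Proof.
move=> [x y]; apply/cvgrPdist_lt => e e0 /=.
have e2 : 0 < e / 2 by rewrite divr_gt0.
exists (ball x (e / 2), ball y (e / 2)); first by split; exact: nbhsx_ballx.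
move=> [a b] /= []; rewrite !ballEmdist /= => xa yb.
have := metric_triangle x a y; have := metric_triangle a b y.
have := metric_triangle a x b; have := metric_triangle x y b.
rewrite [mdist b y]metric_sym [mdist a x]metric_sym => h1 h2 h3 h4.
by rewrite ltr_norml; apply/andP; split; lra.
Qed.

(** A base is given by balls of radius 1/(k+1) about the points of a countable dense set. Their
    interiors are taken because a ball of a pseudometric type need not be open. *)
Lemma separable_second_countable (R : realType) (T : pseudoMetricType R) :
  separable T -> @second_countable T.
Proof.
move=> [S cS dS].
pose B (i : T * nat) := (ball i.1 i.2.+1%:R^-1)° : set T.
exists (B @` (S `*` setT)).
  by apply: (card_le_trans (card_image_le _ _)); exact: countableX.
split; first by move=> _ [i _ <-]; exact: open_interior.
move=> x U /= /nbhs_ballP[e /= e0 xU].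
(* This [k] makes 1/(k+1) less than e/2. The centre [s] is then taken within half of 1/(k+1) of [x],
   so the ball about [s] is a neighbourhood of [x] and stays inside the ball of radius [e] about
   [x]. *)
have [k] := ltr_add_invr (divr_gt0 e0 (ltr0Sn R 1)); rewrite add0r => ke.
have d0 : (0 : R) < k.+1%:R^-1 by rewrite invr_gt0.
have [s [xs Ss]] : (ball x (k.+1%:R^-1 / 2))° `&` S !=set0.
  apply: dS; last exact: open_interior.
  by exists x; apply: nbhsx_ballx; rewrite divr_gt0.
move: xs => /interior_subset /= xs.
exists (B (s, k)) => /=.
  split; first by exists (s, k).
  apply: (@filterS _ _ _ (ball x (k.+1%:R^-1 / 2))).
    move=> y xy; apply: ball_splitl; first exact: (ball_sym xs).
    exact: (ball_sym xy).
  by apply: nbhsx_ballx; rewrite divr_gt0.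
move=> y /interior_subset /= sy; apply: xU.
apply: (@le_ball _ _ _ (k.+1%:R^-1 / 2 + k.+1%:R^-1)); last first.
  exact: ball_triangle sy.
by rewrite [leRHS]splitr ltW// ltrD// (lt_trans _ ke)// ltr_pdivrMr// ltr_pMr// ltr1n.
Qed.

(** Separability need not pass to a subset of a topological space, but second countability does: one
    point of [A] is picked in each basic open set that meets [A]. This will be applied to the
    complement of Omega. *)
Lemma second_countable_dense_subset (T : topologicalType) (A : set T) :
  @second_countable T ->
  exists S : set T, [/\ countable S, S `<=` A &
    forall U, open U -> U `&` A !=set0 -> U `&` S !=set0].
Proof.
move=> [B cB [oB bB]].
pose P := [set U | B U /\ U `&` A !=set0].
have [[a0 Aa0]|A0] := pselect (exists a, A a); last first.
  by exists set0; split => // U _ [x [_ Ax]]; have := A0 (ex_intro _ x Ax).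
have [f fP] : {f : set T -> T & forall U, P U -> (U `&` A) (f U)}.
  apply: (choice (P := fun U x => P U -> (U `&` A) x)) => U.
  have [[_ [x Ux]]|nPU] := pselect (P U); first by exists x.
  by exists a0.
exists (f @` P); split.
- apply: (card_le_trans (card_image_le _ _)).
  by apply: sub_countable cB; apply: subset_card_le => U [].
- by move=> _ [U PU <-]; have [] := fP _ PU.
- move=> U oU [x [Ux Ax]].
  have [V [/= BV Vx] VU] := bB x U (open_nbhs_nbhs (conj oU Ux)).
  have PV : P V by split => //; exists x.
  exists (f V); split; last by exists V.
  by apply: VU; have [] := fP _ PV.
Qed.

(** * Borel measurability of continuous maps and of pairs *)

Section borel_maps.
Context {R : realType}.

Lemma continuous_measurable_borel (S T : ptopologicalType) (f : S -> T) :
  continuous f -> measurable_fun [set: borel S] (f : borel S -> borel T).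
Proof.
move=> /continuousP cf.
apply: (@measurability _ _ (borel S) (borel T) _ _ (@open T)); first by [].
by move=> _ [B oB <-]; rewrite setTI; apply: sub_sigma_algebra; exact: cf.
Qed.

Lemma continuous_measurable_real (S : ptopologicalType) (f : S -> R^o) :
  continuous f -> measurable_fun [set: borel S] (f : borel S -> R).
Proof.
move=> /continuousP cf; apply: (measurability _ (RGenOpens.measurableE R)).
move=> _ [_ [a [b ->] <-]]; rewrite setTI; apply: sub_sigma_algebra; apply: cf.
exact: interval_open.
Qed.

(** The Borel sigma-algebra of a product may exceed the product sigma-algebra. Countable bases make
    every open set a countable union of open rectangles, whose preimages are controlled by the
    components. *)
Lemma measurable_pair_borel d (Z : measurableType d) (S T : ptopologicalType)
    (f : Z -> S) (g : Z -> T) :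
  @second_countable S -> @second_countable T ->
  measurable_fun setT (f : Z -> borel S) ->
  measurable_fun setT (g : Z -> borel T) ->
  measurable_fun setT ((fun z => (f z, g z)) : Z -> borel (S * T)%type).
Proof.
move=> [B cB [oB bB]] [C cC [oC bC]] mf mg.
apply: (@measurability _ _ Z (borel (S * T)%type) _ _ (@open (S * T)%type)) => //.
move=> _ [U oU <-]; rewrite setTI.
pose I := [set i : set S * set T | [/\ B i.1, C i.2 & i.1 `*` i.2 `<=` U]].
have -> : (fun z => (f z, g z)) @^-1` U =
    \bigcup_(i in I) (f @^-1` i.1 `&` g @^-1` i.2).
  apply/seteqP; split => [z Uz|z [i [_ _ iU] [? ?]]]; last exact: iU.
  have [[P Q] /= [Pz Qz] PQU] : nbhs (f z, g z) U.
    by apply: open_nbhs_nbhs; split.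
  have [P' [/= BP' P'z] P'P] := bB _ _ Pz.
  have [Q' [/= CQ' Q'z] Q'Q] := bC _ _ Qz.
  exists (P', Q') => //; split => // -[x y] [/= xP yQ].
  by apply: PQU; split; [exact: P'P | exact: Q'Q].
rewrite bigcup_set_type; apply: countable_bigcupT_measurable.
  rewrite (eq_countable (card_setT I)).
  apply: sub_countable (countableX cB cC).
  by apply: subset_card_le => i [? ? _]; split.
move=> [i /set_mem[Bi Ci _]] /=; apply: measurableI.
- rewrite -[X in measurable X]setTI; apply: mf => //.
  by apply: sub_sigma_algebra; exact: oB.
- rewrite -[X in measurable X]setTI; apply: mg => //.
  by apply: sub_sigma_algebra; exact: oC.
Qed.

End borel_maps.

(** The first index [n] with [E n x] is selected. Its level sets are [E n] minus the earlier sets,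
    so every function of this index is measurable, whatever the points [y n] are. *)
Lemma measurable_first d d' (T : measurableType d) (T' : measurableType d')
    (E : nat -> set T) (y : nat -> T') :
  (forall n, measurable (E n)) -> (forall x, exists n, E n x) ->
  exists2 f : T -> T', measurable_fun setT f &
    forall x, exists2 n, E n x & f x = y n.
Proof.
move=> mE Eex.
have exE x : exists n, `[< E n x >] by have [n ?] := Eex x; exists n; exact/asboolP.
pose N x := ex_minn (exE x).
have NE n : N @^-1` [set n] = E n `\` \bigcup_(k < n) E k.
  apply/seteqP; split => [x <-|x [En nE]].
    rewrite /N; case: ex_minnP => m /asboolP Em mmin; split => // -[k /= km Ek].
    by move: km; rewrite ltnNge => /negP; apply; apply: mmin; exact/asboolP.
  rewrite /preimage /= /N; case: ex_minnP => m /asboolP Em mmin.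
  apply/eqP; rewrite eqn_leq mmin ?andTb; last exact/asboolP.
  by rewrite leqNgt; apply/negP => mn; apply: nE; exists m.
exists (y \o N) => [_ Y mY|x]; last first.
  exists (N x) => //; rewrite /N; by case: ex_minnP => m /asboolP.
rewrite setTI.
have -> : (y \o N) @^-1` Y = \bigcup_(n in [set n | Y (y n)]) (N @^-1` [set n]).
  apply/seteqP; split => [x Yx|x [n Yn]]; first by exists (N x).
  by rewrite /preimage /= => ->.
apply: bigcup_measurable => n _; rewrite NE; apply: measurableD => //.
exact: bigcup_measurable.
Qed.

(** * Push-forward of a restricted measure *)

Section push_restriction.
Local Open Scope ereal_scope.
Context d d' (T : measurableType d) (T' : measurableType d') (R : realType).
Variables (m : {measure set T -> \bar R}) (D : set T) (f : T -> T').
Hypotheses (mD : measurable D) (mf : measurable_fun setT f).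

Definition push_restr : {measure set T' -> \bar R} :=
  measure_function_pushforward__canonical__measure_function_Measure
    (mrestr m mD) mf.

Lemma push_restrE A : push_restr A = m (f @^-1` A `&` D).
Proof. by []. Qed.

Lemma integral_push_restr (h : T' -> \bar R) : (forall x, 0 <= h x) ->
  measurable_fun setT h ->
  \int[push_restr]_x h x = \int[m]_(x in D) h (f x).
Proof.
move=> h0 mh; have mhf : measurable_fun setT (h \o f) by exact: measurableT_comp.
rewrite /push_restr ge0_integral_pushforward// preimage_setT.
rewrite (@ge0_negligible_integral _ _ _ _ _ (~` D))//; last first.
- by rewrite /= /mrestr setICl measure0.
- by move=> x _; exact: h0.
- exact: measurableC.
rewrite setTD setCK; apply: eq_measure_integral => A mA AD /=.
by rewrite /mrestr; congr (m _); apply/setIidPl.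
Qed.

End push_restriction.
Arguments push_restr {d d' T T' R} m {D f}.

(** * Collapse of the complement of Omega to one point *)

Section collapse.
Context {R : realType} {X : metricType R} (Omega : domain X).
Local Notation amb := (ambient Omega).
Local Notation inn := (inner Omega).
Local Notation sc := (shortcut Omega).
Local Notation bd := (bpoint Omega).
Local Notation inc := (@Defs.incl _ _ Omega).

(** [insub] returns [None], the point \partial, exactly outside Omega. *)
Definition collapse (x : amb) : sc := insub (x : X).

Lemma collapse_val (a : inn) : collapse (inner_val a) = Some a.
Proof. exact: valK. Qed.

Lemma collapse_out (x : amb) : ~ (Omega : set X) x -> collapse x = None.
Proof. by move=> Ox; apply: insubN; rewrite notin_setE. Qed.

Lemma in_inner (x : amb) : (Omega : set X) x -> exists a : inn, x = inner_val a.
Proof. by move=> Ox; exists (SigSub (mem_set Ox)). Qed.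

Lemma bdist_out (x : X) : ~ (Omega : set X) x -> bdist Omega x = 0.
Proof.
move=> Ox; apply/eqP; rewrite eq_le bdist_ge0 andbT -(mdistxx x).
exact: bdist_le.
Qed.

Lemma mdist_collapse_bd (x : amb) : mdist (collapse x) bd = bdist Omega x.
Proof.
have [/in_inner[a ->]|Ox] := pselect ((Omega : set X) x).
  by rewrite collapse_val.
by rewrite collapse_out// bdist_out// mdistxx.
Qed.

(** For two points of Omega the minimum is at most its first term. If one point lies outside, the
    left side is the distance of the other to the complement, hence at most the distance to this
    particular point. *)
Lemma mdist_collapse (x y : amb) : mdist (collapse x) (collapse y) <= mdist x y.
Proof.
have [/in_inner[a ->]|Ox] := pselect ((Omega : set X) x).
  have [/in_inner[b ->]|Oy] := pselect ((Omega : set X) y).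
    by rewrite !collapse_val; rewrite {1}/mdist /= ge_min lexx.
  rewrite (collapse_out y)// -[None]/bd mdist_collapse_bd; exact: bdist_le.
rewrite (collapse_out x)// -[None]/bd metric_sym mdist_collapse_bd metric_sym.
exact: bdist_le.
Qed.

Lemma collapse_continuous : continuous collapse.
Proof.
move=> x U /nbhs_ballP[e /= e0 eU].
apply: filterS (nbhsx_ballx x e e0) => y; rewrite ballEmdist /= => xye.
by apply: eU; rewrite ballEmdist /=; exact: le_lt_trans (mdist_collapse x y) xye.
Qed.

(** A left inverse of [incl]. The point \partial goes to the arbitrary base point of Omega, and has
    to be excluded wherever this value matters. *)
Definition uncollapse (z : sc) : inn := odflt point z.

Lemma uncollapse_incl_open (U : set inn) : open U -> open (inc @` U).
Proof.
move=> oU; rewrite openE => _ [a Ua <-]; rewrite /interior.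
have [V [/= oV Va] VU] : exists2 V : set X, open V /\ V (inner_val a) &
    @inner_val _ _ Omega @^-1` V `<=` U.
  have [V oV VU] : wopen (@set_val X Omega) U := oU.
  by exists V; [split=> //; move: Ua; rewrite -VU | rewrite -VU].
have /nbhs_ballP[e /= e0 eV] : nbhs (inner_val a) V by exact: open_nbhs_nbhs.
have a0 : 0 < bdist Omega (inner_val a) by apply: bdist_gt0; exact: set_valP.
(* A radius of at most [bdist] of the centre keeps \partial out of the ball and forces the minimum
   in the shortcut metric to be the original distance, as the other term is no smaller than this
   radius. *)
apply/nbhs_ballP; exists (Num.min e (bdist Omega (inner_val a))) => /=.
  by rewrite lt_min e0.
move=> z; rewrite ballEmdist /= lt_min => /andP[].
case: z => [b|]; rewrite {1 2}/mdist /=; last by rewrite ltxx.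
have b0 := bdist_ge0 Omega (inner_val b).
rewrite minEle; case: ifPn => _ abe ab; last by exfalso; lra.
by exists b => //; apply: VU; apply: eV; rewrite ballEmdist.
Qed.

Lemma measurable_bd : measurable ([set bd] : set (borel sc)).
Proof.
rewrite -[X in measurable X]setCK; apply: measurableC.
apply: sub_sigma_algebra; apply: closed_openC.
exact: accessible_closed_set1 (hausdorff_accessible (@metric_hausdorff R sc)) bd.
Qed.

Lemma measurable_uncollapse :
  measurable_fun [set: borel sc] (uncollapse : borel sc -> borel inn).
Proof.
apply: (@measurability _ _ (borel sc) (borel inn) _ _ (@open inn)); first by [].
move=> _ [U oU <-]; rewrite setTI.
have mU : measurable (inc @` U : set (borel sc)).
  by apply: sub_sigma_algebra; exact: uncollapse_incl_open.
(* The preimage of [U] contains \partial exactly when [U] contains the base point. *)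
have [Up|Up] := pselect (U point).
  have -> : uncollapse @^-1` U = inc @` U `|` [set bd].
    apply/seteqP; split => [[a|] //= ?|[a|] //=]; [by left; exists a|by right|].
    by move=> [[b Ub [<-]]|].
  by apply: measurableU => //; exact: measurable_bd.
have -> : uncollapse @^-1` U = inc @` U; last by [].
by apply/seteqP; split => [[a|] //= ?|[a|] //= [b Ub]]; [exists a|case=> <-|].
Qed.

Lemma measurable_incl_image (A : set (borel inn)) : measurable A ->
  measurable (inc @` A : set (borel sc)).
Proof.
move=> mA; have -> : inc @` A = uncollapse @^-1` A `\` [set bd].
  apply/seteqP; split => [_ [a Aa <-]//|[a|] //= [Aa]]; [by exists a|exact].
apply: measurableD; last exact: measurable_bd.
by rewrite -[X in measurable X]setTI; exact: measurable_uncollapse.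
Qed.

(** Turning the image into a preimage under a continuous map shows that Borel sets of Omega are
    Borel in X. *)
Lemma inner_val_imageE (A : set inn) :
  @inner_val _ _ Omega @` A = collapse @^-1` (inc @` A).
Proof.
apply/seteqP; split => [_ [a Aa <-]|x [a Aa]].
  by exists a; rewrite // collapse_val.
have [/in_inner[b ->]|Ox] := pselect ((Omega : set X) x).
  by rewrite collapse_val => -[<-]; exists a.
by rewrite collapse_out.
Qed.

End collapse.

(** * Measurability and superadditivity of the cost *)

Section costs.
Context {R : realType}.

Lemma continuous_mdist (S : topologicalType) (T : metricType R) (f g : S -> T) :
  continuous f -> continuous g -> continuous (fun z => mdist (f z) (g z) : R^o).
Proof.
move=> cf cg z.
apply: (@continuous_comp _ _ _ (fun z => (f z, g z)) (fun t => mdist t.1 t.2 : R^o)).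
  by apply: cvg_pair; [exact: cf | exact: cg].
exact: mdist_continuous.
Qed.

Lemma measurable_mdist (S : ptopologicalType) (T : metricType R) (f g : S -> T) :
  continuous f -> continuous g ->
  measurable_fun [set: borel S] (fun z : borel S => mdist (f z) (g z)).
Proof.
by move=> cf cg; apply: continuous_measurable_real; exact: continuous_mdist.
Qed.

Lemma measurable_cost (S : ptopologicalType) (T : metricType R) (f g : S -> T)
    (p : R) : continuous f -> continuous g ->
  measurable_fun [set: borel S] (fun z : borel S => (mdist (f z) (g z) `^ p)%:E).
Proof.
move=> cf cg; apply/measurable_EFinP.
by apply: (measurableT_comp (measurable_powR p)); exact: measurable_mdist.
Qed.

(** Each power x^p is written as x times x^(p-1); as p-1 is non-negative, both factors of exponent
    p-1 on the left are at most (a+b)^(p-1). *)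
Lemma powRD_ge (p a b : R) : 1 <= p -> 0 <= a -> 0 <= b ->
  a `^ p + b `^ p <= (a + b) `^ p.
Proof.
move=> p1 a0 b0.
have p0 : p != 0 by rewrite gt_eqF// (lt_le_trans _ p1).
have q0 : 0 <= p - 1 by rewrite subr_ge0.
have pE (x : R) : 0 <= x -> x `^ p = x * x `^ (p - 1).
  rewrite le_eqVlt => /predU1P[<-|x0]; first by rewrite mul0r powR0.
  rewrite -{2}[x]powRr1 ?(ltW x0)// -powRD; first by rewrite addrC subrK.
  by apply/implyP => _; rewrite gt_eqF.
have ab x : 0 <= x -> x <= a + b -> x `^ (p - 1) <= (a + b) `^ (p - 1).
  by move=> x0 xab; apply: ge0_ler_powR; rewrite // nnegrE (le_trans x0).
rewrite !pE ?addr_ge0// mulrDl lerD// ler_wpM2l// ab// ?lerDl ?lerDr//.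
Qed.

End costs.

(** * From partial couplings to couplings on the shortcut space *)

Section partial_to_coupling.
Local Open Scope ereal_scope.
Context {R : realType} {X : metricType R} (Omega : domain X).
Local Notation amb := (ambient Omega).
Local Notation inn := (inner Omega).
Local Notation sc := (shortcut Omega).
Local Notation bd := (bpoint Omega).
Local Notation inc := (@Defs.incl _ _ Omega).
Local Notation val := (@inner_val _ _ Omega).

Lemma measurable_collapse :
  measurable_fun [set: borel amb] (@collapse _ _ Omega : borel amb -> borel sc).
Proof. by apply: continuous_measurable_borel; exact: collapse_continuous. Qed.

Lemma measurable_val_image (A : set (borel inn)) : measurable A ->
  measurable (val @` A : set (borel amb)).
Proof.
move=> mA; rewrite inner_val_imageE -[X in measurable X]setTI.
by apply: measurable_collapse => //; exact: measurable_incl_image.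
Qed.

Lemma inner_val_imageT : val @` setT = Omega.
Proof.
apply/seteqP; split => [_ [a _ <-]|x /(@in_inner _ _ Omega x)[a ->]].
  exact: set_valP.
by exists a.
Qed.

(** Two maps [u] and [v] are used so that exchanging them gives the other marginal, with the same
    [S] and the same atom. [S] consists of [P], of mass [mu setT], and of the part of [Q] outside
    [P], which [u] followed by [collapse] sends to \partial. With the atom, \partial receives g(Q \
    P) + 2 - g(S) = 2 - g(P). *)
Lemma embed_marginal (p : R) (mu nu : Wb1 Omega p) d (Z : measurableType d)
    (g : {measure set Z -> \bar R}) (u v : Z -> amb) :
  measurable_fun setT (u : Z -> borel amb) ->
  measurable_fun setT (v : Z -> borel amb) ->
  (forall A : set (borel inn), measurable A -> g (u @^-1` (val @` A)) = mu A) ->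
  (forall A : set (borel inn), measurable A -> g (v @^-1` (val @` A)) = nu A) ->
  let S := u @^-1` Omega `|` v @^-1` Omega in
  g S <= 2%:E /\
  forall A : set (borel sc), measurable A ->
    g ((@collapse _ _ Omega \o u) @^-1` A `&` S) +
      (2 - fine (g S))%:E * \d_(bd : borel sc) A = embed mu A.
Proof.
move=> mu_ mv gmu gnu S.
set P := u @^-1` Omega; set Q := v @^-1` Omega.
have mO : measurable (Omega : set (borel amb)).
  by rewrite -inner_val_imageT; exact: measurable_val_image.
have mP : measurable P by rewrite /P -[X in measurable X]setTI; exact: mu_.
have mQ : measurable Q by rewrite /Q -[X in measurable X]setTI; exact: mv.
have mQP : measurable (Q `\` P) by exact: measurableD.
have gP : g P = mu setT by rewrite /P -inner_val_imageT gmu.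
have gQ : g Q = nu setT by rewrite /Q -inner_val_imageT gnu.
have SE : S = P `|` (Q `\` P).
  apply/seteqP; split => z; last by case=> [|[]]; [left|right].
  by have [Pz|nPz] := pselect (P z); [left | case=> // Qz; right].
have gS : g S = g P + g (Q `\` P).
  by rewrite SE measureU// setDE setICA setICr setI0.
have P1 : g P <= 1 by rewrite gP Wb1_mass.
have Q1 : g (Q `\` P) <= 1.
  apply: (@le_trans _ _ (g Q)); last by rewrite gQ Wb1_mass.
  by apply: le_measure; rewrite ?inE//; exact: subDsetl.
split; first by rewrite gS (_ : 2%:E = 1 + 1)//; exact: leeD.
move=> A mA.
have mvA : measurable (inc @^-1` A : set (borel inn)).
  by rewrite -[X in measurable X]setTI; exact: measurable_incl.
have muv : measurable (u @^-1` (val @` (inc @^-1` A))).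
  rewrite -[X in measurable X]setTI; apply: mu_ => //.
  exact: measurable_val_image.
have preP : (@collapse _ _ Omega \o u) @^-1` A `&` P = u @^-1` (val @` (inc @^-1` A)).
  apply/seteqP; split => [z [/= Az]|z [a Aa /= uz]].
    by move=> /(@in_inner _ _ Omega (u z))[a uz]; exists a => //;
      move: Az; rewrite uz collapse_val.
  split; first by rewrite /= -uz collapse_val.
  by rewrite /P /= -uz; exact: set_valP.
have preQ : (@collapse _ _ Omega \o u) @^-1` A `&` (Q `\` P) =
    if bd \in A then Q `\` P else set0.
  case: ifPn => [/set_mem|/negP] bA; apply/seteqP; split => z //=.
  - by case.
  - by move=> QPz; split => //; rewrite collapse_out//; case: QPz.
  - move=> [Az [_ /(@collapse_out _ _ Omega (u z)) cu]]; apply: bA.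
    by rewrite inE /bpoint -cu.
rewrite embedE.
have -> : (@collapse _ _ Omega \o u) @^-1` A `&` S =
    u @^-1` (val @` (inc @^-1` A)) `|` (if bd \in A then Q `\` P else set0).
  by rewrite -preP -preQ -setIUr -SE.
set E := if _ then _ else _ in preQ *.
have gU : g (u @^-1` (val @` (inc @^-1` A)) `|` E) = mu (inc @^-1` A) + g E.
  rewrite -(gmu _ mvA); apply: measureU => //; first by rewrite /E; case: ifP.
  rewrite -preP -preQ; apply/seteqP; split => z //= [[_ Pz] [_ [_]]].
  exact.
rewrite gU /E {gU preQ}.
(* Both masses are at most 1, hence finite, and the remaining identity is one between real
   numbers. *)
have fin (x : \bar R) : 0 <= x -> x <= 1 -> exists a, x = a%:E.
  by case: x => // a _ _; exists a.
have [a ga] := fin _ (measure_ge0 g P) P1.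
have [c gc] := fin _ (measure_ge0 g (Q `\` P)) Q1.
rewrite diracE -gP gS ga gc; case: ifPn => bA; last by rewrite measure0 adde0 !mule0.
rewrite !mule1 gc -addeA; congr (_ + _); rewrite -EFinD /=; congr EFin.
lra.
Qed.

Lemma coupling_of_partial (p : R) (mu nu : Wb1 Omega p)
    (g : {measure set (borel (amb * amb)%type) -> \bar R}) :
  (1 <= p)%R -> partial_coupling mu nu g ->
  exists2 g' : {measure set (borel (sc * sc)%type) -> \bar R},
    coupling (embed mu) (embed nu) g' &
    \int[g']_z (mdist z.1 z.2 `^ p)%:E <= \int[g]_z (mdist z.1 z.2 `^ p)%:E.
Proof.
move=> p1 gmunu.
have cfst : continuous (fst : amb * amb -> amb) by move=> z; exact: cvg_fst.
have csnd : continuous (snd : amb * amb -> amb) by move=> z; exact: cvg_snd.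
have mfst : measurable_fun [set: borel (amb * amb)%type] (fst : _ -> borel amb).
  by apply: continuous_measurable_borel; exact: cfst.
have msnd : measurable_fun [set: borel (amb * amb)%type] (snd : _ -> borel amb).
  by apply: continuous_measurable_borel; exact: csnd.
have mO : measurable (Omega : set (borel amb)).
  by rewrite -inner_val_imageT; exact: measurable_val_image.
pose S : set (borel (amb * amb)%type) := fst @^-1` Omega `|` snd @^-1` Omega.
have mS : measurable S.
  by apply: measurableU; rewrite -[X in measurable X]setTI; [exact: mfst|exact: msnd].
pose f (z : borel (amb * amb)%type) : borel (sc * sc)%type :=
  (collapse Omega z.1, collapse Omega z.2).
have cf : continuous (fun z : amb * amb => (collapse Omega z.1, collapse Omega z.2)).
  move=> z; apply: (@cvg_pair _ _ _ (nbhs z) (nbhs (collapse Omega z.1))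
    (nbhs (collapse Omega z.2))).
  - by apply: continuous_comp; [exact: cfst | exact: collapse_continuous].
  - by apply: continuous_comp; [exact: csnd | exact: collapse_continuous].
have mf : measurable_fun setT f.
  exact: (@continuous_measurable_borel (amb * amb)%type (sc * sc)%type).
have [gS2 g1] := @embed_marginal _ mu nu _ _ g fst snd mfst msnd
  (fun A mA => (gmunu A mA).1) (fun A mA => (gmunu A mA).2).
have [_ g2] := @embed_marginal _ nu mu _ _ g snd fst msnd mfst
  (fun A mA => (gmunu A mA).2) (fun A mA => (gmunu A mA).1).
(* The mass bounds on [mu] and [nu] enter here: they give [g S <= 2], which makes the weight of the
   atom non-negative, although [g] may be infinite off [S]. *)
have c0 : (0 <= 2 - fine (g S))%R.
  by move: gS2 (measure_ge0 g S); rewrite -/S; case: (g S) => //= a; rewrite !lee_fin; lra.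
exists (measure_add (push_restr g mS mf)
  (mscale (NngNum c0) (dirac ((bd, bd) : borel (sc * sc)%type)))).
  move=> A mA; split.
    rewrite -g1//; exact: measure_addE.
  rewrite -g2// setUC; exact: measure_addE.
have mc : measurable_fun setT (fun z : borel (sc * sc)%type => (mdist z.1 z.2 `^ p)%:E).
  by apply: measurable_cost => z; [exact: cvg_fst|exact: cvg_snd].
have mc' : measurable_fun setT (fun z : borel (amb * amb)%type => (mdist z.1 z.2 `^ p)%:E).
  exact: measurable_cost.
have c_ge0 (T : metricType R) (z : T * T) : 0 <= (mdist z.1 z.2 `^ p)%:E.
  by rewrite lee_fin powR_ge0.
rewrite ge0_integral_measure_add// integral_push_restr//.
(* The atom contributes a multiple of 0^p, which vanishes because [p] is non-zero. *)
rewrite [X in _ + X <= _](_ : _ = 0) ?adde0; last first.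
  etransitivity; first exact: ge0_integral_mscale.
  rewrite integral_dirac//= mdistxx powR0 ?mule0//.
  by rewrite gt_eqF// (lt_le_trans _ p1).
apply: (@le_trans _ _ (\int[g]_(z in S) (mdist z.1 z.2 `^ p)%:E)); last first.
  exact: ge0_subset_integral.
apply: ge0_le_integral => //.
- apply: measurable_funTS.
  exact: (measurableT_comp mc mf).
- exact: measurable_funTS.
- move=> z _; rewrite lee_fin; apply: ge0_ler_powR; rewrite ?nnegrE ?mdist_ge0//.
    exact: le_trans p1.
  exact: mdist_collapse.
Qed.

End partial_to_coupling.

(** * Total mass and finite moment of the embedded measures *)

Section moment.
Local Open Scope ereal_scope.
Context {R : realType} {X : metricType R} (Omega : domain X).
Local Notation sc := (shortcut Omega).
Local Notation bd := (bpoint Omega).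

Lemma Wb_mzero_lty (p : R) : @Wb R X Omega p mzero mzero < +oo.
Proof.
apply: (@le_lt_trans _ _ (0 `^ p^-1)); last by apply: poweR_lty.
apply: ge_ereal_inf; exists (0 `^ p^-1) => //; exists mzero; first by [].
by rewrite integral_measure_zero.
Qed.

Lemma mzero_mass : @mzero _ (borel (inner Omega)) R setT <= 1.
Proof. exact: lee01. Qed.

(** Packaging the zero measure as a point of [Wb1] allows [coupling_of_partial] to be applied to the
    finiteness condition on [Wb p mu mzero]. *)
Definition Wb1_mzero (p : R) : Wb1 Omega p :=
  @mkWb1 _ _ _ p mzero (Wb_mzero_lty p) mzero_mass.

Lemma embed_mass (p : R) (mu : Wb1 Omega p) : embed mu setT = 2%:E.
Proof.
rewrite embedE preimage_setT diracT mule1.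
have mu_fin : mu setT \is a fin_num.
  by rewrite ge0_fin_numE// (le_lt_trans (Wb1_mass mu))// ltry.
by rewrite -{1}(fineK mu_fin) -EFinD addrC subrK.
Qed.

(** A coupling with the image of the zero measure lives on pairs (z, \partial). *)
Lemma embed_moment (p : R) (mu : Wb1 Omega p) : (1 <= p)%R ->
  \int[embed mu]_x (mdist x bd `^ p)%:E < +oo.
Proof.
move=> p1.
have p0 : (p^-1 != 0)%R by rewrite invr_neq0// gt_eqF// (lt_le_trans _ p1).
(* A finite infimum supplies one partial coupling of finite cost; as [p^-1] is non-zero, the
   integral is finite and not only its power. *)
have := Wb1_finite mu; move/ereal_inf_lt => [_ [g pcg <-]] /(lty_poweRy p0) goo.
have [g' cg' /le_lt_trans/(_ goo)] :=
  @coupling_of_partial _ _ _ p mu (Wb1_mzero p) g p1 pcg.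
apply: le_lt_trans.
have cfst : continuous (fst : sc * sc -> sc) by move=> z; exact: cvg_fst.
have csnd : continuous (snd : sc * sc -> sc) by move=> z; exact: cvg_snd.
have mfst : measurable_fun [set: borel (sc * sc)%type] (fst : _ -> borel sc).
  by apply: continuous_measurable_borel; exact: cfst.
have msnd : measurable_fun [set: borel (sc * sc)%type] (snd : _ -> borel sc).
  by apply: continuous_measurable_borel; exact: csnd.
have cbd (S : topologicalType) : continuous (fun _ : S => bd) by move=> z; exact: cvg_cst.
(* Since [embed mu] is the first marginal of [g'], the moment becomes an integral over pairs. *)
rewrite (eq_measure_integral (push_restr g' measurableT mfst)); last first.
  by move=> A mA _; rewrite push_restrE setIT -(cg' A mA).1.
rewrite integral_push_restr; last 2 first.
- by move=> x; rewrite lee_fin powR_ge0.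
- by apply: measurable_cost; [move=> z; exact: cvg_id | exact: cbd].
apply: ae_ge0_le_integral => //.
- by move=> z _; rewrite lee_fin powR_ge0.
- by apply: measurable_cost; [exact: cfst | exact: cbd].
- by move=> z _; rewrite lee_fin powR_ge0.
- by apply: measurable_cost; [exact: cfst | exact: csnd].
exists (snd @^-1` (~` [set bd])); split.
- rewrite -[X in measurable X]setTI; apply: msnd => //.
  by apply: measurableC; exact: measurable_bd.
- have mC : measurable (~` [set bd] : set (borel sc)).
    by apply: measurableC; exact: measurable_bd.
  have := (cg' _ mC).2; rewrite /marginal2 /pushforward => ->.
  by rewrite embedE /= /mzero add0e diracE memNset ?mule0//=; apply.
- move=> z /= nz z2; apply: nz => _; rewrite -z2; exact: lexx.
Qed.

End moment.

(** * Measurable almost nearest points in the complement of Omega *)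

Section near_projection.
Context {R : realType} {X : metricType R} (Omega : domain X).
Local Notation amb := (ambient Omega).
Local Notation bd := (bpoint Omega).

Lemma measurable_bdist :
  measurable_fun [set: borel amb] (bdist Omega : borel amb -> R).
Proof.
rewrite (_ : bdist Omega = fun x : amb => mdist (collapse Omega x) bd); last first.
  by apply/funext => x; rewrite mdist_collapse_bd.
by apply: measurable_mdist; [exact: collapse_continuous | move=> z; exact: cvg_cst].
Qed.

Lemma bdist_adherent (x : X) (e : R) : bdist Omega x < e ->
  exists2 y : X, ~ (Omega : set X) y & mdist x y < e.
Proof.
move=> xe; apply/not_exists2P => H.
suff : e <= bdist Omega x by rewrite leNgt xe.
apply: lb_le_inf => [|_ [y Oy <-]]; last first.
  by rewrite leNgt; apply/negP; case: (H y).
have [y Oy] : ~` (Omega : set X) !=set0.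
  apply/set0P/eqP => O0; apply: (@domain_proper _ _ Omega).
  by rewrite -[LHS]setCK O0 setC0.
by exists (mdist x y), y.
Qed.

(** A nearest point need not exist. Since [bdist] is positive on Omega, the factor [c > 1] leaves
    room to approximate by a countable dense subset of the complement, and taking the first suitable
    point makes the choice measurable. *)
Lemma near_projection (c : R) : separable X -> 1 < c ->
  exists2 b : amb -> amb,
    measurable_fun [set: borel amb] (b : borel amb -> borel amb) &
    forall x : amb, (Omega : set X) x ->
      ~ (Omega : set X) (b x) /\ mdist x (b x) <= c * bdist Omega x.
Proof.
move=> sepX c1.
have [S [cS SO dS]] := second_countable_dense_subset _ (~` (Omega : set X))
  (separable_second_countable _ _ sepX).
have near (x : amb) : (Omega : set X) x ->
    exists2 s, S s & mdist x s < c * bdist Omega x.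
  move=> Ox; have bx := bdist_gt0 Ox.
  have [y Oy xy] : exists2 y : X, ~ (Omega : set X) y & mdist x y < c * bdist Omega x.
    by apply: bdist_adherent; rewrite ltr_pMl.
  have [s [/interior_subset xs Ss]] :
      (ball (x : X) (c * bdist Omega x))° `&` S !=set0.
    apply: dS; first exact: open_interior.
    exists y; split => //; apply/nbhs_ballP.
    exists (c * bdist Omega x - mdist x y) => /=; first by rewrite subr_gt0.
    move=> z; rewrite !ballEmdist /= ltrBrDl; apply: le_lt_trans.
    exact: metric_triangle.
  by exists s => //; move: xs; rewrite ballEmdist.
(* A countable set is empty or enumerated by the natural numbers; [near] at a point of Omega refutes
   emptiness. *)
have /pfcard_geP[S0|[y]] := cS.
  have [a Oa] := domain_nonempty Omega.
  by have [s] := near a Oa; rewrite S0.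
(* Every [E n] contains the complement of Omega, so that the selection is defined everywhere; no
   condition is imposed on [b] there. *)
pose E n : set (borel amb) :=
  ~` (Omega : set X) `|` [set x | mdist x (y n : amb) < c * bdist Omega x].
have [n|x|b mb bE] := @measurable_first _ _ (borel amb) (borel amb) E y.
- apply: measurableU.
    by apply: measurableC; apply: sub_sigma_algebra; exact: domain_open.
  rewrite [X in measurable X](_ : _ = setT `&`
    (fun x : borel amb => mdist x (y n : amb) < c * bdist Omega x) @^-1` [set true]).
    apply: measurable_fun_ltr => //.
      by apply: measurable_mdist => z; [exact: cvg_id | exact: cvg_cst].
    by apply: measurable_funM => //; exact: measurable_bdist.
  by rewrite setTI; apply/seteqP; split => z /=.
- have [Ox|Ox] := pselect ((Omega : set X) x); last by exists 0%N; left.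
  have [s Ss xs] := near x Ox.
  have [n _ yn] := @surj _ _ _ _ y s Ss.
  by exists n; right; rewrite /= yn.
- exists b => // x Ox; have [n [//|/= xn] ->] := bE x.
  split; last exact: ltW.
  by apply: SO; exact: funS.
Qed.

End near_projection.

(** * From couplings on the shortcut space to partial couplings *)

Section coupling_to_partial.
Local Open Scope ereal_scope.
Context {R : realType} {X : metricType R} (Omega : domain X).
Local Notation amb := (ambient Omega).
Local Notation inn := (inner Omega).
Local Notation sc := (shortcut Omega).
Local Notation bd := (bpoint Omega).
Local Notation inc := (@Defs.incl _ _ Omega).
Local Notation val := (@inner_val _ _ Omega).

(** The value at \partial is a base point inside Omega, so preimages under this map are intersected
    below with sets that avoid \partial. *)
Definition shortcut_val (z : sc) : amb := val (uncollapse Omega z).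

Lemma measurable_shortcut_val :
  measurable_fun [set: borel sc] (shortcut_val : borel sc -> borel amb).
Proof.
apply: (@measurableT_comp _ _ _ _ _ _ (val : borel inn -> borel amb)); last first.
  exact: measurable_uncollapse.
by apply: continuous_measurable_borel; exact: initial_continuous.
Qed.

Lemma shortcut_val_preimage (A : set inn) :
  shortcut_val @^-1` (val @` A) `&` (~` [set bd]) = inc @` A.
Proof.
apply/seteqP; split => [[a|] /= [[a' Aa' /val_inj aa']]|_ [a Aa <-]] //.
- by move=> _; exists a => //; move: Aa'; rewrite (aa' : a' = a).
- by split => //=; exists a.
Qed.

Lemma embed_incl_image (p : R) (mu : Wb1 Omega p) (A : set (borel inn)) :
  embed mu (inc @` A) = mu A.
Proof.
rewrite embedE diracE memNset ?mule0 ?adde0; last by move=> [].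
by congr (mu _); apply/seteqP; split => [a [a' Aa' [<-]]|a Aa] //; exists a.
Qed.

(** The set where [u] avoids \partial is cut into [D] and the rest. The two parts will be
    transported differently, but both keep the coordinate [u], so together they restore its marginal
    on Omega. *)
Lemma shortcut_val_marginal d (Z : measurableType d)
    (g : {measure set Z -> \bar R}) (u : Z -> sc) (D : set Z) (A : set (borel inn)) :
  measurable_fun setT (u : Z -> borel sc) -> measurable D -> measurable A ->
  D `<=` u @^-1` (~` [set bd]) ->
  g ((shortcut_val \o u) @^-1` (val @` A) `&` D) +
  g ((shortcut_val \o u) @^-1` (val @` A) `&` (u @^-1` (~` [set bd]) `\` D)) =
  g (u @^-1` (inc @` A)).
Proof.
move=> mu mD mA Du.
have mB : measurable (u @^-1` (inc @` A)).
  by rewrite -[X in measurable X]setTI; apply: mu => //; exact: measurable_incl_image.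
rewrite (measureDI g mB mD) addeC -shortcut_val_preimage preimage_setI.
congr (g _ + g _); first by rewrite !setDE setIA.
by rewrite -setIA; congr (_ `&` _); apply/esym/setIidr.
Qed.

(** If one point were \partial, both sides of the hypothesis would be equal; otherwise strictness
    rules out the second term of the minimum. *)
Lemma mdist_shortcut_val (z1 z2 : sc) :
  (mdist z1 z2 < mdist z1 bd + mdist z2 bd)%R ->
  [/\ z1 <> bd, z2 <> bd & mdist (shortcut_val z1) (shortcut_val z2) = mdist z1 z2].
Proof.
case: z1 z2 => [a|] [b|]; rewrite /mdist /= ?addr0 ?add0r ?ltxx//.
by rewrite gt_min ltxx orbF => ab; split => //; rewrite min_l// ltW.
Qed.

Lemma partial_of_coupling (p c : R) (mu nu : Wb1 Omega p)
    (g : {measure set (borel (sc * sc)%type) -> \bar R}) :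
  separable X -> (1 <= p)%R -> (1 < c)%R -> coupling (embed mu) (embed nu) g ->
  exists2 g' : {measure set (borel (amb * amb)%type) -> \bar R},
    partial_coupling mu nu g' &
    \int[g']_z (mdist z.1 z.2 `^ p)%:E <=
      (c `^ p)%:E * \int[g]_z (mdist z.1 z.2 `^ p)%:E.
Proof.
move=> sepX p1 c1 gmunu.
have [b mb bO] := @near_projection _ _ Omega c sepX c1.
have p0 : (0 <= p)%R by exact: le_trans p1.
have c0 : (0 <= c)%R by rewrite ltW// (lt_trans _ c1).
have K0 : (0 <= c `^ p)%R by exact: powR_ge0.
have K1 : (1 <= c `^ p)%R.
  rewrite (_ : 1%R = (1 `^ p)%R); last by rewrite powR1.
  by apply: ge0_ler_powR; rewrite ?nnegrE ?ler01// ltW.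
have scX : @second_countable amb by exact: separable_second_countable.
have cfst : continuous (fst : sc * sc -> sc) by move=> z; exact: cvg_fst.
have csnd : continuous (snd : sc * sc -> sc) by move=> z; exact: cvg_snd.
have mfst : measurable_fun [set: borel (sc * sc)%type] (fst : _ -> borel sc).
  by apply: continuous_measurable_borel; exact: cfst.
have msnd : measurable_fun [set: borel (sc * sc)%type] (snd : _ -> borel sc).
  by apply: continuous_measurable_borel; exact: csnd.
have cbd (S : topologicalType) : continuous (fun _ : S => bd) by move=> z; exact: cvg_cst.
have ml1 : measurable_fun [set: borel (sc * sc)%type] (shortcut_val \o fst : _ -> borel amb).
  exact: measurableT_comp measurable_shortcut_val mfst.
have ml2 : measurable_fun [set: borel (sc * sc)%type] (shortcut_val \o snd : _ -> borel amb).
  exact: measurableT_comp measurable_shortcut_val msnd.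
have mbl1 : measurable_fun [set: borel (sc * sc)%type]
    (b \o (shortcut_val \o fst) : _ -> borel amb).
  exact: measurableT_comp mb ml1.
have mbl2 : measurable_fun [set: borel (sc * sc)%type]
    (b \o (shortcut_val \o snd) : _ -> borel amb).
  exact: measurableT_comp mb ml2.
have mbd : measurable (~` [set bd] : set (borel sc)).
  by apply: measurableC; exact: measurable_bd.
pose D : set (borel (sc * sc)%type) :=
  [set z | (mdist z.1 z.2 < mdist z.1 bd + mdist z.2 bd)%R].
have mD : measurable D.
  rewrite [X in measurable X](_ : _ = setT `&`
    (fun z : borel (sc * sc)%type =>
      (mdist z.1 z.2 < mdist z.1 bd + mdist z.2 bd)%R) @^-1` [set true]).
    apply: measurable_fun_ltr => //.
      by apply: measurable_mdist; [exact: cfst | exact: csnd].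
    apply: measurable_funD; apply: measurable_mdist; try exact: cbd.
      exact: cfst.
    exact: csnd.
  by rewrite setTI; apply/seteqP; split => z /=.
(* A pair outside [D] with both points in Omega belongs to [D1] and to [D2] and gives two
   transports, one leaving Omega and one entering it. A pair with exactly one coordinate \partial
   belongs to only one of the two sets. *)
pose D1 : set (borel (sc * sc)%type) := fst @^-1` (~` [set bd]) `\` D.
pose D2 : set (borel (sc * sc)%type) := snd @^-1` (~` [set bd]) `\` D.
have mD1 : measurable D1.
  by apply: measurableD => //; rewrite -[X in measurable X]setTI; exact: mfst.
have mD2 : measurable D2.
  by apply: measurableD => //; rewrite -[X in measurable X]setTI; exact: msnd.
pose F0 (z : borel (sc * sc)%type) : borel (amb * amb)%type :=
  ((shortcut_val \o fst) z, (shortcut_val \o snd) z).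
pose F1 (z : borel (sc * sc)%type) : borel (amb * amb)%type :=
  ((shortcut_val \o fst) z, (b \o (shortcut_val \o fst)) z).
pose F2 (z : borel (sc * sc)%type) : borel (amb * amb)%type :=
  ((b \o (shortcut_val \o snd)) z, (shortcut_val \o snd) z).
have mF0 : measurable_fun [set: borel (sc * sc)%type] (F0 : _ -> borel (amb * amb)%type).
  exact: (measurable_pair_borel _ _ _ _ _ _ scX scX ml1 ml2).
have mF1 : measurable_fun [set: borel (sc * sc)%type] (F1 : _ -> borel (amb * amb)%type).
  exact: (measurable_pair_borel _ _ _ _ _ _ scX scX ml1 mbl1).
have mF2 : measurable_fun [set: borel (sc * sc)%type] (F2 : _ -> borel (amb * amb)%type).
  exact: (measurable_pair_borel _ _ _ _ _ _ scX scX mbl2 ml2).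
have lO z : z <> bd -> (Omega : set X) (shortcut_val z) by case: z => // a _; exact: set_valP.
have bdl z : z <> bd -> bdist Omega (shortcut_val z) = mdist z bd by case: z.
have bl_image (A : set inn) z : z <> bd -> ~ (val @` A) (b (shortcut_val z)).
  move=> /lO /bO[nO _] [a _ ab]; apply: nO; rewrite -ab; exact: set_valP.
exists (measure_add (measure_add (push_restr g mD mF0) (push_restr g mD1 mF1))
  (push_restr g mD2 mF2)).
  move=> A mA; split.
    rewrite -embed_incl_image -(gmunu _ (measurable_incl_image _ _ mA)).1.
    rewrite /restr /marginal1 /pushforward.
    rewrite -(shortcut_val_marginal _ _ g fst D A mfst mD mA); last first.
      by move=> z /mdist_shortcut_val[].
    etransitivity; first exact: measure_addE.
    (* The piece over [D2] starts at values of [b], outside Omega, and adds nothing to the first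
       marginal there. *)
    rewrite [X in _ + X = _](_ : _ = 0) ?adde0; first exact: measure_addE.
    rewrite push_restrE (_ : _ `&` _ = set0) ?measure0//.
    by rewrite -subset0 => z [/= zA [z2 _]]; exact: bl_image z2 zA.
  rewrite -embed_incl_image -(gmunu _ (measurable_incl_image _ _ mA)).2.
  rewrite /restr /marginal2 /pushforward.
  rewrite -(shortcut_val_marginal _ _ g snd D A msnd mD mA); last first.
    by move=> z /mdist_shortcut_val[].
  etransitivity; first exact: measure_addE.
  congr (_ + _); etransitivity; first exact: measure_addE.
  (* For the second marginal it is the piece over [D1] that ends outside Omega. *)
  rewrite [X in _ + X = _](_ : _ = 0) ?adde0//.
  rewrite push_restrE (_ : _ `&` _ = set0) ?measure0//.
  by rewrite -subset0 => z [/= zA [z2 _]]; exact: bl_image z2 zA.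
have mca : measurable_fun setT (fun z : borel (amb * amb)%type => (mdist z.1 z.2 `^ p)%:E).
  by apply: measurable_cost => z; [exact: cvg_fst|exact: cvg_snd].
have mcs : measurable_fun setT (fun z : borel (sc * sc)%type => (mdist z.1 z.2 `^ p)%:E).
  by apply: measurable_cost => z; [exact: cvg_fst|exact: cvg_snd].
have mc1 : measurable_fun setT (fun z : borel (sc * sc)%type => (mdist z.1 bd `^ p)%:E).
  by apply: measurable_cost; [exact: cfst|exact: cbd].
have mc2 : measurable_fun setT (fun z : borel (sc * sc)%type => (mdist z.2 bd `^ p)%:E).
  by apply: measurable_cost; [exact: csnd|exact: cbd].
have c_ge0 (T : metricType R) (x y : T) : 0 <= (mdist x y `^ p)%:E.
  by rewrite lee_fin powR_ge0.
have Kc_ge0 (T : metricType R) (x y : T) : 0 <= (c `^ p)%:E * (mdist x y `^ p)%:E.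
  by rewrite mule_ge0.
have mK := fun h (mh : measurable_fun [set: borel (sc * sc)%type] h) =>
  measurable_funeM (c `^ p)%:E mh.
have near z : z <> bd ->
    (mdist (shortcut_val z) (b (shortcut_val z)) `^ p)%:E <= (c `^ p)%:E * (mdist z bd `^ p)%:E.
  move=> zb; rewrite -EFinM lee_fin -powRM ?mdist_ge0// -bdl//.
  have [_ bl] := bO _ (lO _ zb).
  by apply: ge0_ler_powR => //; rewrite nnegrE ?mdist_ge0// mulr_ge0// bdist_ge0.
do 2 rewrite ge0_integral_measure_add//.
rewrite !integral_push_restr//.
(* The bound is split along [D]: the direct piece is compared on [D], the two detours together on
   its complement. *)
rewrite -ge0_integralZl// -[X in _ <= \int[g]_(_ in X) _](setUv D).
rewrite ge0_integral_setU//; last 3 first.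
- exact: measurableC.
- by rewrite setUv; exact: mK.
- by rewrite disj_set2E setICr.
rewrite -addeA; apply: leeD.
  apply: ge0_le_integral => //.
  - by apply: measurable_funTS; exact: (measurableT_comp mca mF0).
  - by apply: measurable_funTS; exact: mK.
  - move=> z /mdist_shortcut_val[_ _ /= ->].
    by rewrite -EFinM lee_fin ler_peMl// powR_ge0.
(* Enlarging [D1] to the complement of [D], and likewise [D2], puts both detour costs on one set,
   where they can be added pointwise. *)
have I1 : \int[g]_(z in D1) (mdist (F1 z).1 (F1 z).2 `^ p)%:E <=
    \int[g]_(z in ~` D) ((c `^ p)%:E * (mdist z.1 bd `^ p)%:E).
  apply: (@le_trans _ _ (\int[g]_(z in D1) ((c `^ p)%:E * (mdist z.1 bd `^ p)%:E))).
    apply: ge0_le_integral => //.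
    - by apply: measurable_funTS; exact: (measurableT_comp mca mF1).
    - by apply: measurable_funTS; exact: mK.
    - by move=> z [zb _]; exact: near.
  apply: ge0_subset_integral => //; first exact: measurableC.
    by apply: measurable_funTS; exact: mK.
  by move=> z [].
have I2 : \int[g]_(z in D2) (mdist (F2 z).1 (F2 z).2 `^ p)%:E <=
    \int[g]_(z in ~` D) ((c `^ p)%:E * (mdist z.2 bd `^ p)%:E).
  apply: (@le_trans _ _ (\int[g]_(z in D2) ((c `^ p)%:E * (mdist z.2 bd `^ p)%:E))).
    apply: ge0_le_integral => //.
    - by apply: measurable_funTS; exact: (measurableT_comp mca mF2).
    - by apply: measurable_funTS; exact: mK.
    - by move=> z [zb _]; rewrite /= metric_sym; exact: near.
  apply: ge0_subset_integral => //; first exact: measurableC.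
    by apply: measurable_funTS; exact: mK.
  by move=> z [].
apply: le_trans (leeD I1 I2) _.
rewrite -ge0_integralD//; last 3 first.
- exact: measurableC.
- by apply: measurable_funTS; exact: mK.
- by apply: measurable_funTS; exact: mK.
apply: ge0_le_integral => //.
- exact: measurableC.
- by move=> z _; rewrite adde_ge0.
- by apply: emeasurable_funD; apply: measurable_funTS; exact: mK.
- by apply: measurable_funTS; exact: mK.
(* Outside [D] the shortcut distance is at least the sum of the distances to \partial, so
   superadditivity of the power pays for both detours. *)
move=> z /= /negP; rewrite -leNgt => z12.
rewrite -!EFinM -EFinD lee_fin -mulrDr ler_wpM2l//.
apply: (@le_trans _ _ ((mdist z.1 bd + mdist z.2 bd) `^ p)%R).
  by apply: powRD_ge => //; exact: mdist_ge0.
by apply: ge0_ler_powR; rewrite ?nnegrE ?addr_ge0 ?mdist_ge0.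
Qed.

End coupling_to_partial.

(** * Comparison of the two infima *)

Theorem lemma3p3 (R : realType) (X : metricType R) (sepX : separable X)
    (Omega : domain X) (p : R) (p1 : 1 <= p) :
  (forall mu : Wb1 Omega p, twoW p (embed mu)) /\
  (forall mu nu : Wb1 Omega p, W p (embed mu) (embed nu) = Wb p mu nu).
Proof.
have pV0 : 0 <= p^-1 by rewrite invr_ge0 (le_trans _ p1).
have cost_ge0 (T : metricType R) (d : measure_display) (Z : measurableType d)
    (g : {measure set Z -> \bar R}) (u v : Z -> T) :
    (0 <= \int[g]_z (mdist (u z) (v z) `^ p)%:E)%E.
  by apply: integral_ge0 => z _; rewrite lee_fin powR_ge0.
split=> [mu|mu nu]; first by split; [exact: embed_mass | exact: embed_moment].
apply/eqP; rewrite eq_le; apply/andP; split.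
  (* For [W <= Wb], every partial coupling yields a coupling of no larger cost. *)
  apply: le_ereal_inf_tmp => _ [g gmunu <-].
  have [g' cg' gg'] := coupling_of_partial _ _ _ _ _ p1 gmunu.
  apply: (@le_trans _ _ ((\int[g']_z (mdist z.1 z.2 `^ p)%:E) `^ p^-1)%E).
    by apply: ereal_inf_lbound; exists g'.
  by apply: gt0_ler_poweR; rewrite // in_itv /= leey andbT ?cost_ge0.
apply: le_ereal_inf_tmp => _ [g gmunu <-].
have Wb0 : (0 <= Wb p mu nu)%E.
  by apply: le_ereal_inf_tmp => _ [g' _ <-]; exact: poweR_ge0.
(* It suffices to bound [r%:E * Wb p mu nu] for each [r] strictly between 0 and 1. The factor [c] is
   taken to be [r^-1], which replaces a limit as [c] tends to 1. *)
apply/(lee_mul01Pr _ Wb0) => r /andP[r0 r1].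
have rV1 : 1 < r^-1 by rewrite invf_gt1.
have [g' cg' gg'] := partial_of_coupling _ _ _ _ _ _ sepX p1 rV1 gmunu.
(* The power [p^-1] turns the factor c^p into [r^-1], which [r] cancels; [r] then drops out of both
   sides of the inequality. *)
have -> : ((\int[g]_z (mdist z.1 z.2 `^ p)%:E) `^ p^-1 =
    r%:E * (((r^-1 `^ p)%:E * \int[g]_z (mdist z.1 z.2 `^ p)%:E) `^ p^-1))%E.
  rewrite poweRM ?lee_fin ?powR_ge0// poweR_EFin -powRrM mulfV; last first.
    by rewrite gt_eqF// (lt_le_trans _ p1).
  by rewrite powRr1 ?invr_ge0 ?ltW// muleA -EFinM mulfV ?mul1e// gt_eqF.
rewrite lee_pmul2l ?lte_fin//.
apply: (@le_trans _ _ ((\int[g']_z (mdist z.1 z.2 `^ p)%:E) `^ p^-1)%E).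
  by apply: ereal_inf_lbound; exists g'.
apply: gt0_ler_poweR; rewrite // in_itv /= leey andbT ?cost_ge0//.
by rewrite mule_ge0 ?cost_ge0// lee_fin powR_ge0.
Qed.
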